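(* A tournament $T$ on the vertices $\{1,2,\dots,n\}$ is semiacyclic if and only if $T$ contains none of the following directed cycles, for any $a<b<c<d$ in $\{1,\dots,n\}$ (respectively $a<b<c$ for $C_0$): $C_0=(a,b,c)$, $C_1=(a,c,b,d)$, $C_2=(a,d,b,c)$, $C_3=(a,b,d,c)$, $C_4=(a,c,d,b)$.
   Context: A tournament on $\{1,\dots,n\}$ is a loopless directed graph $T$ such that for every $i\ne j$ exactly one of $(i,j)$, $(j,i)$ is in $T$. The notation $(c_1,\dots,c_m)$ denotes the directed cycle with edges $(c_1,c_2),(c_2,c_3),\dots,(c_m,c_1)$; with $c_0:=c_m$, index $i$ is an ascent if $c_{i-1}<c_i$ and a descent if $c_{i-1}>c_i$. A directed cycle is ascending if its number of ascents is at least its number of descents, and a tournament is semiacyclic if it contains no ascending directed cycle. *)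

(* Defs.v *)
From mathcomp Require Import all_boot.

Set Implicit Arguments.
Unset Strict Implicit.
Unset Printing Implicit Defensive.

(** Vertices are ['I_n] = {0, ..., n-1}, an order-preserving shift of {1, ..., n}. *)
Definition tournament (n : nat) (T : rel 'I_n) : Prop :=
  irreflexive T /\ forall i j : 'I_n, i != j -> T i j (+) T j i.

(** [(c_1, ..., c_m)] is the sequence [[:: c_1; ...; c_m]]. The empty sequence,
    which satisfies [cycle], is excluded, and the vertices are distinct. *)
Definition contains_cycle (n : nat) (T : rel 'I_n) (c : seq 'I_n) : bool :=
  [&& c != [::], cycle T c & uniq c].

(** The pairs [(c_{i-1}, c_i)] for [1 <= i <= m], where [c_0 = c_m]. *)
Definition cyclic_steps (n : nat) (c : seq 'I_n) : seq ('I_n * 'I_n) :=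
  zip (rotr 1 c) c.

Definition ascents (n : nat) (c : seq 'I_n) : nat :=
  count (fun p : 'I_n * 'I_n => p.1 < p.2) (cyclic_steps c).

Definition descents (n : nat) (c : seq 'I_n) : nat :=
  count (fun p : 'I_n * 'I_n => p.1 > p.2) (cyclic_steps c).

Definition ascending (n : nat) (c : seq 'I_n) : bool := descents c <= ascents c.

Definition semiacyclic (n : nat) (T : rel 'I_n) : Prop :=
  forall c : seq 'I_n, contains_cycle T c -> ~~ ascending c.

(* Main.v *)
(** Take an ascending cycle [p_0, p_1, ...] of minimal length [m], and suppose [m >= 5].
    By minimality the chord between [p_0] and [p_3], however it is directed, closes a
    non-ascending shorter cycle. Hence [p_3 < p_0] if exactly two of the three steps
    from [p_0] to [p_3] are ascents, and [p_0 < p_3] if exactly one is. If the windows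
    starting at [p_0] and [p_1] had different majorities, the steps [p_0 p_1] and
    [p_3 p_4] would close a cyclic chain of strict inequalities on [p_0, p_1, p_4, p_3].
    So all windows of three steps have the same majority, which must be ascents because
    the cycle is ascending. Then ascents strictly outnumber descents and some
    [p_0 < p_1 < p_2] occurs; either direction of the chord between [p_0] and [p_2]
    closes a shorter ascending cycle. Ascending cycles of length 3 or 4 are, up to
    rotation, one of [C_0], ..., [C_4], or [(a, b, c, d)], in which the chord between
    [a] and [c] closes a [C_0]. *)
Require Import Defs.
From mathcomp Require Import all_boot.
From mathcomp Require Import zify.

Set Implicit Arguments.
Unset Strict Implicit.
Unset Printing Implicit Defensive.

(** * Ascent counts along cycles and their rotations *)

Lemma zip_rot (A B : Type) (k : nat) (s : seq A) (t : seq B) :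
  size s = size t -> zip (rot k s) (rot k t) = rot k (zip s t).
Proof.
move=> eq_sz; have [le_k|/ltnW le_k] := leqP (size s) k.
  by rewrite !rot_oversize // ?size_zip -?eq_sz ?minnn.
rewrite -[in RHS](cat_take_drop k s) -[in RHS](cat_take_drop k t).
rewrite zip_cat ?size_takel -?eq_sz // [in LHS]/rot zip_cat ?size_drop ?eq_sz //.
have := rot_size_cat (zip (take k s) (take k t)) (zip (drop k s) (drop k t)).
by rewrite size_zip !size_takel ?minnn -?eq_sz.
Qed.

(** Unlike [cyclic_steps], this unfolds by computation one step at a time, so a chord can replace an
    initial stretch of a cycle. *)
Definition path_ascents (n : nat) (x : 'I_n) (s : seq 'I_n) : nat :=
  count id (pairmap (fun a b : 'I_n => a < b) x s).

Lemma cyclic_steps_cons (n : nat) (x : 'I_n) (s : seq 'I_n) :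
  perm_eq (cyclic_steps (x :: s)) (pairmap pair x (rcons s x)).
Proof.
have pairmapE y (t : seq 'I_n) z :
  pairmap pair y (rcons t z) = rcons (zip (belast y t) t) (last y t, z).
  by elim: t y => //= u t IHt y; rewrite IHt.
rewrite pairmapE /cyclic_steps perm_sym perm_rcons.
by rewrite [in rotr 1 _]lastI rotr1_rcons.
Qed.

Lemma ascents_cons (n : nat) (x : 'I_n) (s : seq 'I_n) :
  ascents (x :: s) = path_ascents x (rcons s x).
Proof.
rewrite /ascents (permP (cyclic_steps_cons x s)) /path_ascents.
by move: (rcons s x) => t; elim: t x => //= y t IHt x; rewrite IHt.
Qed.

Lemma ascents_rot (n k : nat) (c : seq 'I_n) : ascents (rot k c) = ascents c.
Proof.
rewrite /ascents /cyclic_steps -rot_rotr.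
rewrite zip_rot ?size_rotr //.
by apply/permP; rewrite perm_rot.
Qed.

(** Irreflexivity makes consecutive vertices distinct, so every step is either an ascent or a
    descent. *)
Lemma ascending_double (n : nat) (T : rel 'I_n) (c : seq 'I_n) :
  irreflexive T -> contains_cycle T c ->
  ascending c = (size c <= (ascents c).*2).
Proof.
move=> irrT /and3P[]; case: c => // x s _ pathT _.
suff e : ascents (x :: s) + descents (x :: s) = size (x :: s).
  by rewrite /ascending -addnn -e leq_add2l.
rewrite /ascents /descents !(permP (cyclic_steps_cons x s)).
move: pathT; rewrite -[size _]/((size s).+1) -(size_rcons s x) /=.
move: (rcons s x) => t; elim: t x => //= y t IHt z /andP[Tzy /IHt <-].
have : z != y :> nat by apply/eqP=> /val_inj e; rewrite e irrT in Tzy.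
by case: ltngtP => // _ _; lia.
Qed.

Lemma contains_cycle_rot (n k : nat) (T : rel 'I_n) (c : seq 'I_n) :
  contains_cycle T (rot k c) = contains_cycle T c.
Proof. by rewrite /contains_cycle rot_cycle rot_uniq -!size_eq0 size_rot. Qed.

Lemma rot_mkseq (A : Type) (x0 : A) (c : seq A) (k : nat) :
  rot (k %% size c) c = mkseq (fun i => nth x0 c ((k + i) %% size c)) (size c).
Proof.
apply: (@eq_from_nth _ x0) => [|i]; rewrite ?size_mkseq size_rot // => lt_i.
have lt_k : k %% size c < size c by rewrite ltn_mod; case: (c) lt_i.
rewrite nth_mkseq // nth_cat size_drop nth_drop -modnDml.
case: ifP => lt_ki; first by rewrite [(_ + i) %% _]modn_small //; lia.
rewrite nth_take; last by lia.
congr nth; rewrite -[LHS](@modn_small _ (size c)); last by lia.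
by rewrite -[LHS]modnDl; congr (_ %% _); lia.
Qed.

Lemma ascents_mkseq (n m : nat) (f : nat -> 'I_n) :
  f m = f 0 -> ascents (mkseq f m) = \sum_(i < m) (f i < f i.+1).
Proof.
case: m => [|m] fm; first by rewrite big_ord0.
rewrite /mkseq ascents_cons -[in rcons _ _]fm -map_rcons -cats1.
rewrite -(iotaD 1 m 1) addn1 -/(iota _ _).
have gen j p : path_ascents (f j) (map f (iota j.+1 p)) =
  \sum_(i < p) (f (j + i) < f (j + i).+1).
  elim: p j => [|p IHp] j; first by rewrite big_ord0.
  rewrite big_ord_recl addn0 -[LHS]/((f j < f j.+1) + path_ascents (f j.+1) _) IHp.
  by congr (_ + _); apply: eq_bigr => i _; rewrite addSnnS.
by rewrite gen.
Qed.

Lemma tournament_total (n : nat) (T : rel 'I_n) (i j : 'I_n) :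
  tournament T -> i != j -> T i j || T j i.
Proof. by case=> _ tot /tot; case: (T i j). Qed.

(** * Chords of a minimal ascending cycle of length at least five *)

Section MinimalCycle.

Variables (n : nat) (T : rel 'I_n) (m : nat).
Hypothesis tourT : tournament T.
Hypothesis short_not_ascending : forall c : seq 'I_n,
  size c < m -> contains_cycle T c -> (ascents c).*2 < size c.

(** The chord [p0 -> p3] gives a cycle of length [m - 2], whose failure to ascend forces
    [a > 1 + (p0 < p3)]. The chord [p3 -> p0] gives a 4-cycle and forces [a + (p3 < p0) < 2]. *)
Lemma window_chord (p0 p1 p2 p3 p4 : 'I_n) (r : seq 'I_n) :
    let c := [:: p0, p1, p2, p3, p4 & r] in
    let a := (p0 < p1) + (p1 < p2) + (p2 < p3) in
    size c = m -> contains_cycle T c -> m <= (ascents c).*2 ->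
  (a = 1 -> p0 < p3) /\ (a = 2 -> p3 < p0).
Proof.
move=> c a sz_c /and3P[_ + +] asc_c; rewrite {1 2}/c => cyc_c uniq_c.
have ne03 : p0 != p3 by apply: contraTneq uniq_c => ->; rewrite /= !inE eqxx !orbT.
have ne03_nat : p0 != p3 :> nat := ne03.
have asc_cE : ascents c = a + path_ascents p3 (rcons (p4 :: r) p0).
  by rewrite ascents_cons -!addnA.
have sz_r : size c = (size r).+4.+1 by [].
have /orP[T03|T30] := tournament_total tourT ne03.
  have := short_not_ascending (c := [:: p0, p3, p4 & r]).
  rewrite ascents_cons -[path_ascents p0 _]/((p0 < p3) + path_ascents p3 (rcons (p4 :: r) p0)).
  have -> : contains_cycle T [:: p0, p3, p4 & r].
    move: cyc_c uniq_c; rewrite /contains_cycle /= T03 => /and5P[_ _ _ -> ->].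
    by rewrite !inE !negb_or => /and4P[/and5P[_ _ -> -> ->] _ _ ->].
  by rewrite /= in asc_cE *; lia.
have := short_not_ascending (c := [:: p0; p1; p2; p3]).
rewrite ascents_cons.
rewrite -[path_ascents p0 _]/((p0 < p1) + ((p1 < p2) + ((p2 < p3) + ((p3 < p0) + 0)))).
have -> : contains_cycle T [:: p0; p1; p2; p3].
  move: cyc_c uniq_c; rewrite /contains_cycle /= T30 => /and5P[-> -> -> _ _].
  by rewrite !inE !negb_or => /and4P[/and5P[-> -> -> _ _] /and4P[-> -> _ _] /and3P[-> _ _] _].
by rewrite /= in asc_cE *; lia.
Qed.

Definition ascending_window (p0 p1 p2 p3 : 'I_n) : bool :=
  1 < (p0 < p1) + (p1 < p2) + (p2 < p3).

(** The windows share two steps. If their majorities differ, exactly one shared step is an ascent,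
    so the counts are 1 and 2 and [window_chord] applies to both. The result is
    [p0 < p1 < p4 < p3 < p0] or the reverse. *)
Lemma ascending_window_shift (p0 p1 p2 p3 p4 : 'I_n) (r : seq 'I_n) :
    let c := [:: p0, p1, p2, p3, p4 & r] in
    size c = m -> contains_cycle T c -> m <= (ascents c).*2 ->
  ascending_window p1 p2 p3 p4 = ascending_window p0 p1 p2 p3.
Proof.
move=> c sz_c cyc_c asc_c.
have [w1 w2] := window_chord sz_c cyc_c asc_c.
(* Rotate so that the second window comes first; when [r] is empty, [p5] is [p0]. *)
have : exists p5 r', rot 1 c = [:: p1, p2, p3, p4, p5 & r'].
  by rewrite rot1_cons; case: (r) => [|p5 r'] /=; do 2!eexists.
case=> p5 [r' e1]; move: sz_c cyc_c asc_c.
rewrite -(size_rot 1) -(contains_cycle_rot 1) -(ascents_rot 1) e1 => sz_c cyc_c asc_c.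
have [w1' w2'] := window_chord sz_c cyc_c asc_c.
by move: w1 w2 w1' w2'; rewrite /ascending_window; lia.
Qed.

(** The chord [p0 -> p2] shortens the cycle by one step and loses one ascent, which only excludes a
    strict majority of ascents. The chord [p2 -> p0] would close an ascending triangle. *)
Lemma double_ascent_short (p0 p1 p2 p3 : 'I_n) (r : seq 'I_n) :
    let c := [:: p0, p1, p2, p3 & r] in
    size c = m -> contains_cycle T c -> p0 < p1 -> p1 < p2 ->
  (ascents c).*2 <= m.
Proof.
move=> c sz_c /and3P[_ + +] lt01 lt12; rewrite {1 2}/c => cyc_c uniq_c.
have ne02 : p0 != p2 by apply: contraTneq (ltn_trans lt01 lt12) => ->; rewrite ltnn.
have asc_cE : ascents c = 2 + path_ascents p2 (rcons (p3 :: r) p0).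
  rewrite ascents_cons.
  rewrite -[path_ascents p0 _]/((p0 < p1) + ((p1 < p2) + path_ascents p2 (rcons (p3 :: r) p0))).
  by rewrite lt01 lt12.
have sz_r : size c = (size r).+4 by [].
have /orP[T02|T20] := tournament_total tourT ne02.
  have := short_not_ascending (c := [:: p0, p2, p3 & r]).
  rewrite ascents_cons -[path_ascents p0 _]/((p0 < p2) + path_ascents p2 (rcons (p3 :: r) p0)).
  rewrite (ltn_trans lt01 lt12).
  have -> : contains_cycle T [:: p0, p2, p3 & r].
    move: cyc_c uniq_c; rewrite /contains_cycle /= T02 => /and4P[_ _ -> ->].
    by rewrite !inE !negb_or => /and3P[/and4P[_ -> -> ->] _ ->].
  by rewrite /= in asc_cE *; lia.
have := short_not_ascending (c := [:: p0; p1; p2]).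
rewrite ascents_cons.
rewrite -[path_ascents p0 _]/((p0 < p1) + ((p1 < p2) + ((p2 < p0) + 0))).
rewrite lt01 lt12.
have -> : contains_cycle T [:: p0; p1; p2].
  move: cyc_c uniq_c; rewrite /contains_cycle /= T20 => /and4P[-> -> _ _].
  by rewrite !inE !negb_or => /and3P[/and4P[-> -> _ _] /and3P[-> _ _] _].
by rewrite /= in asc_cE *; lia.
Qed.

Lemma long_not_ascending (c : seq 'I_n) :
  4 < m -> size c = m -> contains_cycle T c -> (ascents c).*2 < m.
Proof.
move=> m_gt4 sz_c cyc_c; rewrite ltnNge; apply/negP => asc_c.
have x0 : 'I_n by case: (c) cyc_c.
(* Read the cycle as an [m]-periodic sequence, so that windows may wrap around. *)
pose f k := nth x0 c (k %% m).
have fm k : f (k + m) = f k by rewrite /f modnDr.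
have rotE k : rot (k %% m) c = mkseq (fun i => f (k + i)) m.
  by rewrite /f -sz_c; exact: rot_mkseq.
have rotE5 k : exists r, rot (k %% m) c = [:: f k, f k.+1, f k.+2, f k.+3, f k.+4 & r].
  rewrite rotE -(subnKC m_gt4) /mkseq /= addn0 !addnS addn0.
  by eexists.
pose w k : nat := f k < f k.+1.
pose W k := ascending_window (f k) (f k.+1) (f k.+2) (f k.+3).
have WS k : W k.+1 = W k.
  have [r e] := rotE5 k.
  apply: (@ascending_window_shift _ _ _ _ _ r); rewrite -e ?size_rot //.
    by rewrite contains_cycle_rot.
  by rewrite ascents_rot.
have W0 k : W k = W 0 by elim: k => // k; rewrite WS.
have ascE : ascents c = \sum_(i < m) w i.
  rewrite -(ascents_rot (0 %% m)) rotE ascents_mkseq //; exact: fm.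
have shift_sum g : (forall k, g (k + m) = g k :> nat) ->
    \sum_(i < m) g i.+1 = \sum_(i < m) g i.
  move=> gm; case: (m) gm => [|m'] gm; first by rewrite !big_ord0.
  by rewrite big_ord_recr big_ord_recl /= addnC -(gm 0).
have wm k : w (k + m) = w k by rewrite /w -addSn !fm.
(* Each step lies in exactly three windows. *)
have asc3E : \sum_(i < m) (w i + w i.+1 + w i.+2) = 3 * ascents c.
  rewrite !big_split /= (shift_sum (fun i => w i.+1)) => [|k]; last by rewrite -addSn wm.
  by rewrite shift_sum // -ascE; lia.
case: (boolP (W 0)) => [W0T|W0F].
  have : \sum_(i < m) 2 <= 3 * ascents c.
    by rewrite -asc3E; apply: leq_sum => i _; move: (W0 i); rewrite W0T.
  rewrite sum_nat_const card_ord => asc_gt.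
  (* If the window at 0 has no two consecutive ascents, its steps go up, down, up. The window at 1
     then starts with a descent, so its other two steps ascend and [k = 2] works. *)
  have [k /andP[lt01 lt12]] : exists k, (f k < f k.+1) && (f k.+1 < f k.+2).
    move: (W0T) (WS 0); rewrite /W /ascending_window => maj0 maj1.
    have [//|N0] := boolP ((f 0 < f 1) && (f 1 < f 2)); first by exists 0.
    have [//|N1] := boolP ((f 1 < f 2) && (f 2 < f 3)); first by exists 1.
    exists 2; lia.
  have [r e] := rotE5 k.
  have := @double_ascent_short (f k) (f k.+1) (f k.+2) (f k.+3) (f k.+4 :: r).
  by rewrite -e; cbv zeta; rewrite size_rot contains_cycle_rot ascents_rot; lia.
(* With at most one ascent per window, at most a third of the steps ascend. *)
have : 3 * ascents c <= \sum_(i < m) 1.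
  rewrite -asc3E; apply: leq_sum => i _; move: (W0 i).
  by rewrite (negPf W0F) /W /ascending_window /w; lia.
by rewrite sum_nat_const card_ord; lia.
Qed.

End MinimalCycle.

(** * Cycles of length at most four, and the induction on length *)

Section ShortCycles.

Variables (n : nat) (T : rel 'I_n).
Hypothesis tourT : tournament T.
Hypothesis noC0 : forall a b c : 'I_n,
  a < b -> b < c -> ~~ contains_cycle T [:: a; b; c].
Hypothesis noC1234 : forall a b c d : 'I_n, a < b -> b < c -> c < d ->
  [/\ ~~ contains_cycle T [:: a; c; b; d],
      ~~ contains_cycle T [:: a; d; b; c],
      ~~ contains_cycle T [:: a; b; d; c] &
      ~~ contains_cycle T [:: a; c; d; b]].

(** Two ascents of a triangle are cyclically consecutive, so some rotation is a [C_0]. *)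
Lemma triangle_not_ascending (x y z : 'I_n) :
  contains_cycle T [:: x; y; z] -> (ascents [:: x; y; z]).*2 < 3.
Proof.
move=> cyc; have neg0 a b c : contains_cycle T [:: a; b; c] -> ~~ ((a < b) && (b < c)).
  by move=> cyc'; apply/negP => /andP[ab bc]; rewrite (negPf (noC0 ab bc)) in cyc'.
have := cyc; rewrite -(contains_cycle_rot 1) => /neg0.
have := cyc; rewrite -(contains_cycle_rot 2) => /neg0.
have := neg0 _ _ _ cyc.
by rewrite ascents_cons /path_ascents /=; lia.
Qed.

Lemma quadrilateral_min_not_ascending (x y z w : 'I_n) :
    contains_cycle T [:: x; y; z; w] -> x < y -> x < z -> x < w ->
  (ascents [:: x; y; z; w]).*2 < 4.
Proof.
move=> cyc xy xz xw; rewrite ltnNge; apply/negP.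
rewrite ascents_cons /path_ascents /= xy => asc2.
have [_] := and3P cyc.
rewrite /= !inE !negb_or => /and5P[Txy Tyz Tzw Twx _].
case/and4P=> /and3P[nxy nxz nxw] /andP[nyz nyw] nzw _.
have : z != w :> nat by [].
have : y != w :> nat by [].
have : y != z :> nat by [].
(* Since [x] is minimal, [x -> y] ascends and [w -> x] descends. The order [w < z < y] leaves a
   single ascent; the other five orders give [(a, b, c, d)], [C_3], [C_4], [C_1], [C_2] in turn. *)
case: (ltngtP y z) => // yz _; case: (ltngtP y w) => // yw _;
  case: (ltngtP z w) => // zw _; try lia.
- have /orP[Txz|Tzx] := tournament_total tourT nxz.
    have := noC0 xz zw.
    by rewrite /contains_cycle /= !inE !negb_or Txz Tzw Twx nxz nxw nzw.
  have := noC0 xy yz.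
  by rewrite /contains_cycle /= !inE !negb_or Txy Tyz Tzx nxy nxz nyz.
- by have [_ _ /negP[]] := noC1234 xy yw zw.
- by have [_ _ _ /negP[]] := noC1234 xw yw yz.
- by have [/negP[]] := noC1234 xz yz yw.
- by have [_ /negP[]] := noC1234 xz zw yw.
Qed.

Lemma quadrilateral_not_ascending (x y z w : 'I_n) :
  contains_cycle T [:: x; y; z; w] -> (ascents [:: x; y; z; w]).*2 < 4.
Proof.
move=> cyc; have [_ _] := and3P cyc.
rewrite /= !inE !negb_or => /and4P[/and3P[nxy nxz nxw] /andP[nyz nyw] nzw _].
have neq (i j : 'I_n) : i != j -> i < j \/ j < i.
  by move=> ne; apply/orP; rewrite -neq_ltn.
have [xmin|[ymin|[zmin|wmin]]] :
    [&& x < y, x < z & x < w] \/ [&& y < z, y < w & y < x] \/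
    [&& z < w, z < x & z < y] \/ [&& w < x, w < y & w < z].
- have := (neq _ _ nxy, neq _ _ nxz, neq _ _ nxw, neq _ _ nyz, neq _ _ nyw, neq _ _ nzw).
  by case; case; case; case; case; lia.
- by case/and3P: xmin; exact: quadrilateral_min_not_ascending.
- rewrite -(ascents_rot 1); case/and3P: ymin.
  by apply: quadrilateral_min_not_ascending; rewrite -(contains_cycle_rot 1) in cyc.
- rewrite -(ascents_rot 2); case/and3P: zmin.
  by apply: quadrilateral_min_not_ascending; rewrite -(contains_cycle_rot 2) in cyc.
- rewrite -(ascents_rot 3); case/and3P: wmin.
  by apply: quadrilateral_min_not_ascending; rewrite -(contains_cycle_rot 3) in cyc.
Qed.

(** Strong induction on length replaces the choice of a minimal ascending cycle: the induction
    hypothesis is [short_not_ascending]. *)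
Lemma cycle_not_ascending (c : seq 'I_n) :
  contains_cycle T c -> (ascents c).*2 < size c.
Proof.
have [k] := ubnP (size c); elim: k c => // k IHk c le_ck cyc.
have [sz|sz] := ltnP 4 (size c).
  apply: (long_not_ascending tourT _ sz _ cyc) => // c' lt_c'.
  by apply: IHk; exact: leq_trans lt_c' _.
case: c cyc {le_ck} sz => [|x [|y [|z [|w [|? ?]]]]] // cyc _.
- by move: cyc; rewrite /contains_cycle /= tourT.1.
- have /and3P[_ /= /and3P[Txy Tyx _]] := cyc; rewrite inE andbT => ne.
  by have := tourT.2 _ _ ne; rewrite Txy Tyx.
- exact: triangle_not_ascending.
- exact: quadrilateral_not_ascending.
Qed.

End ShortCycles.

Theorem theorem8p6 (n : nat) (T : rel 'I_n) (hT : tournament T) :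
  semiacyclic T <->
  (forall a b c : 'I_n, a < b -> b < c -> ~~ contains_cycle T [:: a; b; c]) /\
  (forall a b c d : 'I_n, a < b -> b < c -> c < d ->
     [/\ ~~ contains_cycle T [:: a; c; b; d],
         ~~ contains_cycle T [:: a; d; b; c],
         ~~ contains_cycle T [:: a; b; d; c] &
         ~~ contains_cycle T [:: a; c; d; b]]).
Proof.
split=> [semi | [noC0 noC1234] c cyc]; last first.
  by rewrite (ascending_double hT.1 cyc) -ltnNge (cycle_not_ascending hT).
have no_asc c : size c <= (ascents c).*2 -> ~~ contains_cycle T c.
  move=> asc; apply/negP => cyc; have := semi c cyc.
  by rewrite (ascending_double hT.1 cyc) asc.
(* [C_0] has two ascents in three steps, and each of [C_1], ..., [C_4] has two in four. *)
split=> [a b c ab bc | a b c d ab bc cd]; last split; apply: no_asc.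
all: by rewrite ascents_cons /path_ascents /=; lia.
Qed.
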